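(* Suppose there exists an algorithm that reports an $\epsilon$-approximate solution for instances in $\mathcal{I}_{n,d,R,\rho,M}$ with at most $u$ queries to the full-information first-order oracle based on a first-order chart $\mathcal{G}$. Then, for any subclass of finitely many instances $\mathcal{I}\subset\mathcal{I}_{n,d,R,\rho,M}$, there exists a query strategy for this subclass using the general binary oracle based on $\mathcal{G}$ that reports an $\epsilon$-approximate solution by making at most $$O\big(\log|\mathcal{I}|+u\big)$$ queries.
   Context: **Problem.** A mixed-integer convex optimization instance $(f,C)$ is $\inf\{f(\mathbf{x},\mathbf{y}): (\mathbf{x},\mathbf{y})\in C\cap(\mathbb{Z}^n\times\mathbb{R}^d)\}$, with $f:\mathbb{R}^n\times\mathbb{R}^d\to\mathbb{R}$ convex and $C\subseteq\mathbb{R}^n\times\mathbb{R}^d$ closed and convex. A feasible solution is a point of $C\cap(\mathbb{Z}^n\times\mathbb{R}^d)$. An $\epsilon$-approximate solution is a feasible $(\mathbf{x},\mathbf{y})$ with $f(\mathbf{x},\mathbf{y})\le f(\mathbf{x}',\mathbf{y}')+\epsilon$ for all feasible $(\mathbf{x}',\mathbf{y}')$. **Class $\mathcal{I}_{n,d,R,\rho,M}$.** All instances such that: (i) $C\subseteq\{\mathbf{z}:\|\mathbf{z}\|_\infty\le R\}$; (ii) if $(\mathbf{x}^\star,\mathbf{y}^\star)$ is an optimal solution, there is $\hat{\mathbf{y}}\in\mathbb{R}^d$ with $\{(\mathbf{x}^\star,\mathbf{y}):\|\mathbf{y}-\hat{\mathbf{y}}\|_\infty\le\rho\}\subseteq C$;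 (iii) for every $\mathbf{x}\in[-R,R]^n\cap\mathbb{Z}^n$, $f$ is Lipschitz with respect to $\|\cdot\|_\infty$ with constant $M$ on $\{\mathbf{x}\}\times[-R,R]^d$. **Query strategies.** An oracle for a class of instances is a family $\mathcal{Q}$ of queries, each a function from instances to a response set $H$. A query strategy is a function $D:(\mathcal{Q}\times H)^*\to\mathcal{Q}$ choosing the next query from the sequence of previous query-response pairs. It reports an $\epsilon$-approximate solution with $k$ queries if, for every instance in the class, an $\epsilon$-approximate solution can be output based on the first $k$ query-response pairs (equivalently, all instances in the class consistent with those responses have a common $\epsilon$-approximate solution). The query strategy may depend on the (known) chart $\mathcal{G}$ and on the (known) finite class $\mathcal{I}$. **First-order charts and oracles $\mathcal{O}(\mathcal{G},\mathcal{H})$.** A first-order chart $\mathcal{G}$ consists, for every $\mathbf{z}\in[-R,R]^{n+d}$, of maps on instances: $\mathbf{g}^{\mathrm{sep}}_{\mathbf{z}}(f,C)\in\mathbb{R}^{n+d}$, equal to $\mathbf{0}$ if $\mathbf{z}\in C$ and otherwise a norm-1 vector with $C\subseteq\{\mathbf{z}':\langle\mathbf{g}^{\mathrm{sep}}_{\mathbf{z}}(f,C),\mathbf{z}'\rangle<\langle\mathbf{g}^{\mathrm{sep}}_{\mathbf{z}}(f,C),\mathbf{z}\rangle\}$; $\mathbf{g}^{\mathrm{val}}_{\mathbf{z}}(f,C)=f(\mathbf{z})$; and $\mathbf{g}^{\mathrm{sub}}_{\mathbf{z}}(f,C)\in\partial f(\mathbf{z})$. Queries of $\mathcal{O}(\mathcal{G},\mathcal{H})$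 are pairs $(\mathbf{z},h)$ with $h\in\mathcal{H}=\mathcal{H}^{\mathrm{sep}}\cup\mathcal{H}^{\mathrm{val}}\cup\mathcal{H}^{\mathrm{sub}}$; the response is $h$ applied to $\mathbf{g}^{\mathrm{sep}}_{\mathbf{z}}$, $\mathbf{g}^{\mathrm{val}}_{\mathbf{z}}$ or $\mathbf{g}^{\mathrm{sub}}_{\mathbf{z}}$ of the unknown instance, respectively. In the full-information first-order oracle based on $\mathcal{G}$, $\mathcal{H}$ consists only of the identity functions. In the general binary oracle based on $\mathcal{G}$, $\mathcal{H}$ consists of all $\{0,1\}$-valued functions on $\mathbb{R}^{n+d}$ (separating hyperplanes), on $\mathbb{R}$ (function values) and on $\mathbb{R}^{n+d}$ (subgradients). $O(\cdot)$ hides an absolute constant factor. *)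

(* Defs.v *)
From HB Require Import structures.
From mathcomp Require Import all_boot all_order all_algebra.
From mathcomp Require Import all_classical all_reals all_analysis.
Set Implicit Arguments.
Unset Strict Implicit.
Unset Printing Implicit Defensive.
Import Order.TTheory GRing.Theory Num.Theory.
Import numFieldNormedType.Exports.
Local Open Scope classical_set_scope.
Local Open Scope ring_scope.

(* A point (x, y) of R^n x R^d is the row vector [row_mx x y] of R^(n+d);
   the norm `| _ | of a row vector is the sup norm. *)

Section Instances.
Context {R : realType} {n d : nat}.
Implicit Types z g : 'rV[R]_(n + d).

Record instance := Instance {
  objective : 'rV[R]_(n + d) -> R;
  domain : set 'rV[R]_(n + d) }.

Definition integral_vec (m : nat) (x : 'rV[R]_m) : Prop :=
  forall j, x 0 j \is a Num.int.

Definition feasible (I : instance) : set 'rV[R]_(n + d) :=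
  [set z | domain I z /\ integral_vec (lsubmx z)].

Definition approx_solution (eps : R) (I : instance) : set 'rV[R]_(n + d) :=
  [set z | feasible I z /\
    forall z', feasible I z' -> objective I z <= objective I z' + eps].

Definition optimal_solution (I : instance) : set 'rV[R]_(n + d) :=
  [set z | feasible I z /\
    forall z', feasible I z' -> objective I z <= objective I z'].

Definition box (r : R) (m : nat) : set 'rV[R]_m := [set z | `|z| <= r].

(* An instance without feasible solutions has no eps-approximate solution that
   could be reported, so nonemptiness of the feasible set is part of the
   class; otherwise no strategy would solve all the instances of the class. *)
Definition instance_class (r rho M : R) : set instance :=
  [set I |
    [/\ convex_function (setT : set (convex_lmodType 'rV[R]_(n + d)))
          (objective I),
        convex_set (domain I : set (convex_lmodType 'rV[R]_(n + d))),
        closed (domain I) &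
        feasible I !=set0] /\
    [/\ domain I `<=` @box r (n + d),
        forall (x : 'rV[R]_n) (y : 'rV[R]_d),
          optimal_solution I (row_mx x y) ->
          exists yhat : 'rV[R]_d,
            [set row_mx x y' | y' in [set y' : 'rV[R]_d | `|y' - yhat| <= rho]]
              `<=` domain I &
        forall x : 'rV[R]_n, @box r n x -> integral_vec x ->
          M.-lipschitz_(@box r d)
            ((fun y => objective I (row_mx x y)) : 'rV[R]_d -> R^o)]].

Definition inner m (g z : 'rV[R]_m) : R := \sum_j g 0 j * z 0 j.

Definition subdifferential (f : 'rV[R]_(n + d) -> R) z : set 'rV[R]_(n + d) :=
  [set g | forall z', f z + inner g (z' - z) <= f z'].

Record fo_maps := FoMaps {
  gsep : 'rV[R]_(n + d) -> instance -> 'rV[R]_(n + d);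
  gval : 'rV[R]_(n + d) -> instance -> R;
  gsub : 'rV[R]_(n + d) -> instance -> 'rV[R]_(n + d) }.

(* Separating vectors are normalized in the Euclidean norm. *)
Definition first_order_chart (r : R) (J : set instance) (G : fo_maps) : Prop :=
  forall z I, @box r (n + d) z -> J I ->
    [/\ domain I z -> gsep G z I = 0,
        ~ domain I z ->
          inner (gsep G z I) (gsep G z I) = 1 /\
          domain I `<=`
            [set z' | inner (gsep G z I) z' < inner (gsep G z I) z],
        gval G z I = objective I z &
        subdifferential (objective I) z (gsub G z I)].

(* A query (z, h); the constructor records which of the three families
   h belongs to, hence which map of the chart it is applied to. *)
Inductive fo_query (H : Type) : Type :=
  | SepQuery of 'rV[R]_(n + d) & ('rV[R]_(n + d) -> H)
  | ValQuery of 'rV[R]_(n + d) & (R -> H)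
  | SubQuery of 'rV[R]_(n + d) & ('rV[R]_(n + d) -> H).

Definition response (G : fo_maps) (H : Type) (q : fo_query H) (I : instance) :
    H :=
  match q with
  | SepQuery z h => h (gsep G z I)
  | ValQuery z h => h (gval G z I)
  | SubQuery z h => h (gsub G z I)
  end.

Record query_family (H : Type) := QueryFamily {
  hsep : set ('rV[R]_(n + d) -> H);
  hval : set (R -> H);
  hsub : set ('rV[R]_(n + d) -> H) }.

Definition oracle_queries (r : R) (H : Type) (F : query_family H) :
    set (fo_query H) :=
  [set q | match q with
           | SepQuery z h => @box r (n + d) z /\ hsep F h
           | ValQuery z h => @box r (n + d) z /\ hval F h
           | SubQuery z h => @box r (n + d) z /\ hsub F h
           end].

(* The only members are the identity functions, injected into the common
   response set R^(n+d) + R. *)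
Definition full_information : query_family ('rV[R]_(n + d) + R) :=
  QueryFamily [set inl] [set inr] [set inl].

Definition general_binary : query_family bool :=
  QueryFamily setT setT setT.

End Instances.

Arguments instance : clear implicits.
Arguments fo_maps : clear implicits.
Arguments fo_query : clear implicits.

Section Strategies.
Context {R : realType} {n d : nat} {H : Type}.

Definition query_strategy : Type :=
  seq (fo_query R n d H * H) -> fo_query R n d H.

Fixpoint transcript (G : fo_maps R n d) (D : query_strategy)
    (I : instance R n d) (k : nat) : seq (fo_query R n d H * H) :=
  if k is k'.+1 then
    let s := transcript G D I k' in rcons s (D s, response G (D s) I)
  else [::].

Definition reports (r : R) (G : fo_maps R n d) (F : query_family H)
    (J : set (instance R n d)) (eps : R) (D : query_strategy) (k : nat) :
    Prop :=
  (forall s, oracle_queries r F (D s)) /\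
  exists out : seq (fo_query R n d H * H) -> 'rV[R]_(n + d),
    forall I, J I -> approx_solution eps I (out (transcript G D I k)).

End Strategies.

(* Main.v *)
Require Import Defs.
From mathcomp Require Import all_boot all_order all_algebra.
From mathcomp Require Import all_classical all_reals all_analysis.
From mathcomp Require Import zify lra.
Import Order.TTheory GRing.Theory Num.Theory.

(** Let S be the set of instances of the finite subclass that are consistent
    with the answers so far, and consider the next query of the full-information
    strategy. The values of its response on S can be cut in two by a binary
    query such that, whatever the answer, either S shrinks by a factor 2/3 or
    the full-information response becomes the same on all of S. In the second
    case one full-information query has been simulated; the first case occurs
    at most log_{3/2} |I| times before S is a singleton. *)

Local Open Scope nat_scope.

Lemma balanced_or_constant_split (T : finType) (V : Type) (c : T -> V)
    (S : {set T}) :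
  exists h : V -> bool, forall b : bool,
    let Sb := [set x in S | h (c x) == b]%SET in
    3 * #|Sb| <= 2 * #|S| \/ {in Sb &, forall x y, c x = c y}.
Proof.
pose part h := [set x in S | h (c x)]%SET.
have cardN h : #|[set x in S | h (c x) == false]%SET| = #|S| - #|part h|.
  rewrite -(cardsID (part h) S) (finset.setIidPr _); last first.
    by apply/fintype.subsetP => x; rewrite inE => /andP[].
  rewrite addKn; apply: eq_card => x.
  by rewrite !inE eqbF_neg andbC; case: (x \in S) => //=; rewrite ?andbF ?andbT.
have cardT h : [set x in S | h (c x) == true]%SET = part h.
  by apply/setP => x; rewrite !inE eqb_id.
(* Shrink the part as long as it has at least a third of S; a part that is
   larger than 2/3 and not constant loses at most half of itself when the rarer
   of two of its values is removed. *)
suff H m h : #|part h| <= m -> #|S| <= 3 * #|part h| ->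
    exists h' : V -> bool, #|S| <= 3 * #|part h'| /\
      (3 * #|part h'| <= 2 * #|S| \/ {in part h' &, forall x y, c x = c y}).
  have [||h [Sh hP]] := H #|S| predT.
  - by apply/subset_leq_card/fintype.subsetP => x; rewrite inE => /andP[].
  - suff -> : part predT = S by lia.
    by apply/setP => x; rewrite inE andbT.
  (* The part has at least a third of [S], so the [false] side always shrinks; only the [true] side
     may have to be constant. *)
  exists h => -[] /=; first by rewrite cardT.
  by left; rewrite cardN; lia.
elim: m h => [|m IH] h hm Sh; first by exists h; split=> //; left; lia.
have [le23|gt23] := leqP (3 * #|part h|) (2 * #|S|).
  by exists h; split=> //; left.
have [cst|] := pselect {in part h &, forall x y, c x = c y}.
  by exists h; split=> //; right.
move=> /existsNP[x /existsNP[y /not_implyP[xh /not_implyP[yh cxy]]]].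
pose del v w := h w && ~~ `[< w = v >].
(* Since [c x] and [c y] differ, every element survives one of the two deletions, so the larger
   remainder exceeds a third of [S]. *)
have cover : part h = (part (del (c x)) :|: part (del (c y)))%SET.
  apply/setP => z; rewrite !inE /del -!andb_orr; case: (z \in S) (h (c z)) => -[]//=.
  by apply/esym/orP; have [zx|zx] := asboolP (c z = c x); [right|left];
    rewrite // -zx in cxy *; apply/asboolPn.
have lt z : z \in part h -> #|part (del (c z))| < #|part h|.
  move=> zh; apply/proper_card/properP; split.
    by apply/fintype.subsetP => w; rewrite !inE => /and3P[-> ->].
  by exists z => //; rewrite inE /del asboolT// !andbF.
have := cardsU (part (del (c x))) (part (del (c y))); rewrite -cover => cardU.
have [Sx|Sx] := leqP #|S| (3 * #|part (del (c x))|).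
  by apply: (IH (del (c x))) => //; have := lt x xh; lia.
by apply: (IH (del (c y))); [have := lt y yh|]; lia.
Qed.

Section Simulation.
Context {R : realType} {n d : nat} {H : Type}.
Implicit Types (G : fo_maps R n d) (r : R) (I : instance R n d).

Definition map_query {H'} (h : H -> H') (q : fo_query R n d H) :
    fo_query R n d H' :=
  match q with
  | SepQuery z g => SepQuery z (h \o g)
  | ValQuery z g => ValQuery z (h \o g)
  | SubQuery z g => SubQuery z (h \o g)
  end.

Lemma response_map_query {H'} G (h : H -> H') q I :
  response G (map_query h q) I = h (response G q I).
Proof. by case: q. Qed.

Lemma map_query_general_binary {r} {F : @query_family R n d H} {q}
    (h : H -> bool) :
  oracle_queries r F q -> oracle_queries r general_binary (map_query h q).
Proof. by case: q => z g [zr _]. Qed.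

(** [transcript] appends at the end, so the head is the oldest answer; it selects a strategy that
    then sees only its own history. *)
Definition branch (q : fo_query R n d H) (D : H -> @query_strategy R n d H) :
    @query_strategy R n d H :=
  fun s => if s is (_, a) :: s' then D a s' else q.

Lemma transcript_branch G q D I k :
  transcript G (branch q D) I k.+1 =
    let a := response G q I in (q, a) :: transcript G (D a) I k.
Proof. by elim: k => // k IH; rewrite [LHS]/= -/(transcript _ _ _ k.+1) IH. Qed.

End Simulation.

(** Here [i] queries are already simulated, [j] remain, and [l] bounds the shrinkings: #|S| <
    (3/2)^(l+1), so [l] of them leave at most one index. Each splitting query lowers [j] or [l],
    hence the count [j + l]. *)
Lemma binary_simulation {R : realType} {n d : nat} {H : Type}
    (r : R) (G : fo_maps R n d) (F : @query_family R n d H)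
    (D : @query_strategy R n d H) (T : finType) (f : T -> instance R n d)
    (j l i : nat) (S : {set T}) :
  (forall s, oracle_queries r F (D s)) ->
  2 ^ l.+1 * #|S| < 3 ^ l.+1 ->
  {in S &, forall x y, transcript G D (f x) i = transcript G D (f y) i} ->
  exists D' : @query_strategy R n d bool,
    (forall s, oracle_queries r general_binary (D' s)) /\
    {in S &, forall x y,
      transcript G D' (f x) (j + l) = transcript G D' (f y) (j + l) ->
      transcript G D (f x) (i + j) = transcript G D (f y) (i + j)}.
Proof.
move=> Dr; move def_m: (j + l) => m.
(* The number of queries is fixed in advance; [D0] pads it with a legal query once nothing is left
   to learn. *)
pose D0 : @query_strategy R n d bool := fun=> map_query xpredT (D [::]).
have D0r s : oracle_queries r general_binary (D0 s).
  exact: map_query_general_binary (Dr _).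
elim: m j l i S def_m => [|m IH] j l i S jlm Sl eqS.
all: have [j0|j_gt0] := posnP j.
all: try by exists D0; split=> // x y xS yS _; rewrite j0 addn0; exact: eqS.
  by lia.
have [l0|l_gt0] := posnP l.
  have /card_le1_eqP S1 : #|S| <= 1 by move: Sl; rewrite l0 !expn1; lia.
  by exists D0; split=> // x y xS yS _; rewrite (S1 x y xS yS).
have [->|[x0 x0S]] := set_0Vmem S.
  by exists D0; split=> // x y; rewrite inE.
(* All of [S] shares the history of [x0], so [q] is the next query of [D] on every member. *)
pose q := D (transcript G D (f x0) i).
have [h hP] :=
  balanced_or_constant_split T H (fun x => response G q (f x)) S.
have /choice[D' D'P] : forall b : bool, exists D' : @query_strategy R n d bool,
    (forall s, oracle_queries r general_binary (D' s)) /\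
    {in [set x in S | h (response G q (f x)) == b]%SET &, forall x y,
      transcript G D' (f x) m = transcript G D' (f y) m ->
      transcript G D (f x) (i + j) = transcript G D (f y) (i + j)}.
  move=> b; set Sb := [set x in S | _ == b]%SET.
  have SbS : {subset Sb <= S} by move=> x; rewrite inE => /andP[].
  have [le23|cst] := hP b.
    have [|||D' [D'r D'P]] := IH j l.-1 i Sb; first by lia.
    - move: Sl; rewrite -(prednK l_gt0) !(expnS _ l.-1.+1) => Sl.
      have : 2 ^ l.-1.+1 * (3 * #|Sb|) <= 2 ^ l.-1.+1 * (2 * #|S|).
        by rewrite leq_mul2l le23 orbT.
      by move: Sl; move: (2 ^ l.-1.+1) (3 ^ l.-1.+1) #|Sb| #|S| => P Q B A; nia.
    - by move=> x y /SbS + /SbS; apply: eqS.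
    by exists D'.
  have [|||D' [D'r D'P]] := IH j.-1 l i.+1 Sb; first by lia.
  - apply: leq_ltn_trans Sl; rewrite leq_mul2l.
    by apply/orP; right; apply/subset_leq_card/fintype.subsetP.
  - move=> x y xb yb.
    rewrite /= (eqS _ _ (SbS _ xb) x0S) (eqS _ _ (SbS _ yb) x0S).
    by rewrite -/q (cst _ _ xb yb).
  exists D'; split=> // x y xb yb.
  have -> : i + j = i.+1 + j.-1 by lia.
  exact: D'P.
exists (branch (map_query h q) D'); split.
  by case=> [|[p b] s]; [exact: map_query_general_binary (Dr _)|apply: (D'P b).1].
move=> x y xS yS; rewrite !transcript_branch /= !response_map_query.
case=> hxy; rewrite hxy; have [_] := D'P (h (response G q (f y))).
by apply; rewrite inE ?xS ?yS ?hxy eqxx.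
Qed.

Local Open Scope classical_set_scope.
Local Open Scope ring_scope.

(** The bound ln(1 + x) <= x at x = -1/3 gives ln(3/2) >= 1/3, and truncation plus one strictly
    exceeds 3 ln N; hence N < (3/2)^(L+1). *)
Lemma lt_expn_truncn_ln {R : realType} (N : nat) :
  (2 ^ (Num.truncn (3 * ln (N%:R : R))).+1 * N
    < 3 ^ (Num.truncn (3 * ln (N%:R : R))).+1)%N.
Proof.
set L := Num.truncn _.
case: (posnP N) => [->|N_gt0]; first by rewrite muln0 expn_gt0.
have N0 : (0 : R) < N%:R by rewrite ltr0n.
have ln23 : 1 / 3 <= - ln (2 / 3 : R).
  have := @le_ln1Dx R (- (1 / 3)) ltac:(lra).
  by rewrite (_ : 1 - 1 / 3 = 2 / 3); lra.
have lnN : ln (N%:R : R) < - ln (2 / 3 : R) *+ L.+1.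
  have := truncnS_gt (3 * ln (N%:R : R)); rewrite -/L => ltL.
  rewrite -[ltRHS]mulr_natr.
  have : (1 / 3) * L.+1%:R <= - ln (2 / 3 : R) * L.+1%:R by rewrite ler_wpM2r.
  lra.
have p23 : 0 < (2 / 3 : R) by lra.
have : N%:R * (2 / 3) ^+ L.+1 < 1 :> R.
  rewrite -ltr_ln ?posrE ?mulr_gt0 ?exprn_gt0 // ln1 lnM ?posrE ?exprn_gt0 //.
  by rewrite lnXn //; move: lnN; rewrite mulNrn; lra.
rewrite expr_div_n mulrA ltr_pdivrMr ?exprn_gt0 // mul1r.
by rewrite -!natrX -natrM ltr_nat mulnC.
Qed.

Theorem theorem12 :
  exists K : nat,
  forall (R : realType) (n d : nat) (r rho M eps : R) (u : nat)
    (G : fo_maps R n d),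
  first_order_chart r (instance_class r rho M) G ->
  (exists (D : query_strategy) (k : nat),
     (k <= u)%N /\
     reports r G full_information (instance_class r rho M) eps D k) ->
  forall (J : set (instance R n d)) (N : nat),
  J `<=` instance_class r rho M ->
  (J #= `I_N)%card ->
  exists (D : query_strategy) (k : nat),
    (k%:R <= K%:R * (ln (N%:R : R) + u%:R)) /\
    reports r G general_binary J eps D k.
Proof.
exists 3%N => R n d r rho M eps u G _ [D [k [ku [Dr [out outP]]]]] J N Jclass.
move=> /card_bijP[g [g' gK _]].
pose I_ (i : 'I_N) := val (g' (exist _ (i : nat) (mem_set (ltn_ord i)))).
have I_J i : J (I_ i) by exact: set_mem (valP (g' _)).
have I_onto I : J I -> exists i, I_ i = I.
  move=> JI; pose a : J := exist _ I (mem_set JI).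
  have gN : (val (g a) < N)%N by exact: set_mem (valP (g a)).
  exists (Ordinal gN); rewrite /I_ (_ : exist _ _ _ = g a) ?gK //.
  exact: val_inj.
pose L := Num.truncn (3 * ln (N%:R : R)).
have [||D' [D'r D'P]] :=
  binary_simulation r G full_information D _ I_ k L 0 [set: 'I_N]%SET Dr.
- by rewrite cardsT card_ord; exact: lt_expn_truncn_ln.
- by [].
exists D', (k + L)%N; split.
  (* For an empty subclass this relies on the convention [ln 0 = 0]. *)
  have ln0N : 0 <= ln (N%:R : R).
    by case: (N) => [|N']; [rewrite ln0|apply: ln_ge0; rewrite ler1n].
  have : L%:R <= 3 * ln (N%:R : R) by rewrite truncn_le mulr_ge0.
  have : k%:R <= u%:R :> R by rewrite ler_nat.
  have : 0 <= k%:R :> R by [].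
  by rewrite natrD; lra.
split=> //.
(* Any instance consistent with the binary transcript will do: it yields the same full-information
   transcript as the true one, hence the same output. The default 0 is for transcripts that no
   instance of the subclass produces. *)
exists (fun t =>
  if pselect (exists i, transcript G D' (I_ i) (k + L) = t) is left ex then
    out (transcript G D (I_ (projT1 (cid ex))) k) else 0).
move=> I JI; have [i <-] := I_onto I JI.
case: pselect => [ex|]; last by case; exists i.
case: cid => i' /= /D'P; rewrite !inE add0n => -> //.
exact/outP/Jclass.
Qed.
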